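(* Let $q\ge1$. None of the ten equations (1)–(10) of the PBS-calculus (listed in the context) is a consequence of the others: for each $i\in\{1,\dots,10\}$, the smallest congruence on $\mathrm{PBS}_q$-terms containing the structural congruence and all instances of the nine equations $(j)$, $j\neq i$, does not contain all instances of equation $(i)$.
   Context: Fix an integer $q\ge 1$. Syntax. $\mathrm{PBS}_q$-terms, each of a type $n\to n$ ($n\in\mathbb N$), are generated by: the empty diagram $\varepsilon:0\to0$, the wire $\mathrm{id}:1\to1$, the negation $\neg:1\to1$, the swap $\sigma:2\to2$, the polarising beam splitter $\beta:2\to2$, a gate $\gamma_U:1\to1$ for each $U\in\mathbb C^{q\times q}$; sequential composition $D_2\circ D_1:n\to n$ for $D_1,D_2:n\to n$; parallel composition $D_1\otimes D_2:n+m\to n+m$ for $D_1:n\to n$, $D_2:m\to m$; trace $Tr(D):n\to n$ for $D:n+1\to n+1$. A congruence is a type-preserving equivalence relation on terms compatible with $\circ$, $\otimes$ and $Tr$. Let $I_0=\varepsilon$, $I_{k+1}=I_k\otimes\mathrm{id}$; $\sigma_{1,0}=\mathrm{id}$, $\sigma_{1,k+1}=(I_k\otimes\sigma)\circ(\sigma_{1,k}\otimes\mathrm{id})$; $Tr_0(D)=D$, $Tr_{k+1}(D)=Tr(Tr_k(D))$. Diagrams are terms modulo the structural congruence, the smallest congruence containing all well-typed instances of: $(D_3\circ D_2)\circ D_1=D_3\circ(D_2\circ D_1)$; $I_k\circ D=D=D\circ I_k$; $\varepsilon\otimes D=D=D\otimes\varepsilon$; $(D_1\otimes D_2)\otimes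 D_3=D_1\otimes(D_2\otimes D_3)$; $(D_3\circ D_1)\otimes(D_4\circ D_2)=(D_3\otimes D_4)\circ(D_1\otimes D_2)$; $\sigma_{1,k}\circ(\mathrm{id}\otimes D)=(D\otimes\mathrm{id})\circ\sigma_{1,k}$ for $D:k\to k$; $\sigma\circ\sigma=I_2$; $Tr(D_1\otimes D_2)=D_1\otimes Tr(D_2)$; $Tr(D_2\circ(D_1\otimes\mathrm{id}))=Tr(D_2)\circ D_1$; $Tr((D_2\otimes\mathrm{id})\circ D_1)=D_2\circ Tr(D_1)$; $Tr_k((I_n\otimes D_2)\circ D_1)=Tr_k(D_1\circ(I_n\otimes D_2))$ for $D_2:k\to k$, $D_1:n+k\to n+k$; $Tr(\sigma)=\mathrm{id}$. Equations of the PBS-calculus. The following are equations (schemes) whose instances range over all $U,V\in\mathbb C^{q\times q}$ ($I$ is the identity matrix): (1) $\mathrm{id}=\gamma_I$; (2) $\gamma_U\circ\neg=\neg\circ\gamma_U$; (3) $\beta\circ(\gamma_U\otimes\gamma_U)=(\gamma_U\otimes\gamma_U)\circ\beta$; (4) $Tr((\mathrm{id}\otimes\gamma_V)\circ\beta\circ(\mathrm{id}\otimes\gamma_U)\circ\beta)=Tr((\mathrm{id}\otimes\gamma_U)\circ\beta)$; (5) $(\neg\otimes\neg)\circ\beta\circ(\neg\otimes\neg)=\sigma\circ\beta$; (6) $\gamma_V\circ\gamma_U=\gamma_{VU}$; (7) $Tr(\gamma_U)=\varepsilon$; (8) $\beta\circ\beta=\mathrm{id}\otimes\mathrm{id}$;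 (9) $(\beta\otimes\mathrm{id})\circ(\mathrm{id}\otimes\beta)\circ(\beta\otimes\mathrm{id})=(\sigma\otimes\mathrm{id})\circ(\mathrm{id}\otimes\beta)\circ(\sigma\otimes\mathrm{id})$; (10) $\beta\circ(\neg\otimes\mathrm{id})\circ\beta=(\neg\otimes\mathrm{id})\circ\beta\circ(\neg\otimes\mathrm{id})$. *)

(* Defs.v *)
From mathcomp Require Import all_boot all_order all_algebra.
From mathcomp Require Import reals complex.

Set Implicit Arguments.
Unset Strict Implicit.
Unset Printing Implicit Defensive.

Declare Scope pbs_scope.
Delimit Scope pbs_scope with PBS.

Reserved Notation "D1 ⊗ D2" (at level 40, left associativity).
Reserved Notation "D2 ∘ D1" (at level 50, left associativity).

(* The field of complex numbers is [complex R] for a [R : realType].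
   Terms are raw syntax; [typed D n] below says that D is a term of type
   n -> n. The typing is kept outside the syntax so that, e.g., the two sides
   of the associativity of ⊗ need no transport between the propositionally
   equal types (n + m) + p and n + (m + p). *)
Inductive term (R : realType) (q : nat) : Type :=
| Empty
| Wire
| Neg
| Swap
| Beam
| Gate of 'M[complex R]_q
| Seq of term R q & term R q
| Par of term R q & term R q
| Tr of term R q.

Arguments Empty {R q}.
Arguments Wire {R q}.
Arguments Neg {R q}.
Arguments Swap {R q}.
Arguments Beam {R q}.

Bind Scope pbs_scope with term.

(* As in function composition, D1 comes first in [D2 ∘ D1]. *)
Notation "D2 ∘ D1" := (Seq D2 D1) : pbs_scope.
Notation "D1 ⊗ D2" := (Par D1 D2) : pbs_scope.

Local Open Scope pbs_scope.

Inductive typed (R : realType) (q : nat) : term R q -> nat -> Prop :=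
| typed_Empty : typed Empty 0
| typed_Wire : typed Wire 1
| typed_Neg : typed Neg 1
| typed_Swap : typed Swap 2
| typed_Beam : typed Beam 2
| typed_Gate U : typed (Gate U) 1
| typed_Seq n D2 D1 : typed D2 n -> typed D1 n -> typed (D2 ∘ D1) n
| typed_Par n m D1 D2 : typed D1 n -> typed D2 m -> typed (D1 ⊗ D2) (n + m)
| typed_Tr n D : typed D n.+1 -> typed (Tr D) n.

Section Congruences.
Variables (R : realType) (q : nat).
Local Notation term := (term R q).

Fixpoint idn (k : nat) : term :=
  if k is k'.+1 then idn k' ⊗ Wire else Empty.

Fixpoint swap1 (k : nat) : term :=
  if k is k'.+1 then (idn k' ⊗ Swap) ∘ (swap1 k' ⊗ Wire) else Wire.

Definition trn (k : nat) (D : term) : term := iter k (@Tr R q) D.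

(* In [E n D D'], n is the common type of D and D'. *)
Definition typed_rel := nat -> term -> term -> Prop.

(* The smallest congruence containing E. *)
Inductive congruence_closure (E : typed_rel) : typed_rel :=
| cc_base n D D' : E n D D' -> congruence_closure E n D D'
| cc_refl n D : typed D n -> congruence_closure E n D D
| cc_sym n D D' : congruence_closure E n D D' -> congruence_closure E n D' D
| cc_trans n D D' D'' :
    congruence_closure E n D D' -> congruence_closure E n D' D'' ->
    congruence_closure E n D D''
| cc_Seq n D2 D2' D1 D1' :
    congruence_closure E n D2 D2' -> congruence_closure E n D1 D1' ->
    congruence_closure E n (D2 ∘ D1) (D2' ∘ D1')
| cc_Par n m D1 D1' D2 D2' :
    congruence_closure E n D1 D1' -> congruence_closure E m D2 D2' ->
    congruence_closure E (n + m) (D1 ⊗ D2) (D1' ⊗ D2')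
| cc_Tr n D D' :
    congruence_closure E n.+1 D D' -> congruence_closure E n (Tr D) (Tr D').

Inductive structural_axiom : typed_rel :=
| sa_SeqA n D1 D2 D3 :
    typed D1 n -> typed D2 n -> typed D3 n ->
    structural_axiom n ((D3 ∘ D2) ∘ D1) (D3 ∘ (D2 ∘ D1))
| sa_idSeq k D : typed D k -> structural_axiom k (idn k ∘ D) D
| sa_Seqid k D : typed D k -> structural_axiom k D (D ∘ idn k)
| sa_EmptyPar n D : typed D n -> structural_axiom n (Empty ⊗ D) D
| sa_ParEmpty n D : typed D n -> structural_axiom n D (D ⊗ Empty)
| sa_ParA n m p D1 D2 D3 :
    typed D1 n -> typed D2 m -> typed D3 p ->
    structural_axiom (n + m + p) ((D1 ⊗ D2) ⊗ D3) (D1 ⊗ (D2 ⊗ D3))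
| sa_interchange n m D1 D2 D3 D4 :
    typed D1 n -> typed D3 n -> typed D2 m -> typed D4 m ->
    structural_axiom (n + m) ((D3 ∘ D1) ⊗ (D4 ∘ D2)) ((D3 ⊗ D4) ∘ (D1 ⊗ D2))
| sa_swap_natural k D :
    typed D k ->
    structural_axiom k.+1 (swap1 k ∘ (Wire ⊗ D)) ((D ⊗ Wire) ∘ swap1 k)
| sa_SwapK : structural_axiom 2 (Swap ∘ Swap) (idn 2)
| sa_superposing n m D1 D2 :
    typed D1 n -> typed D2 m.+1 ->
    structural_axiom (n + m) (Tr (D1 ⊗ D2)) (D1 ⊗ Tr D2)
| sa_tightening_r n D1 D2 :
    typed D1 n -> typed D2 n.+1 ->
    structural_axiom n (Tr (D2 ∘ (D1 ⊗ Wire))) (Tr D2 ∘ D1)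
| sa_tightening_l n D1 D2 :
    typed D1 n.+1 -> typed D2 n ->
    structural_axiom n (Tr ((D2 ⊗ Wire) ∘ D1)) (D2 ∘ Tr D1)
| sa_sliding n k D1 D2 :
    typed D1 (n + k) -> typed D2 k ->
    structural_axiom n (trn k ((idn n ⊗ D2) ∘ D1)) (trn k (D1 ∘ (idn n ⊗ D2)))
| sa_yanking : structural_axiom 1 (Tr Swap) Wire.

Definition structural_congruence : typed_rel :=
  congruence_closure structural_axiom.

(* [pbs_equation i] is the set of instances of equation (i) of the
   PBS-calculus, for i = 1, ..., 10; it is empty for the other values of i. *)
Inductive pbs_equation : nat -> typed_rel :=
| pbs_eq1 : pbs_equation 1 1 Wire (Gate 1%:M)
| pbs_eq2 U : pbs_equation 2 1 (Gate U ∘ Neg) (Neg ∘ Gate U)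
| pbs_eq3 U :
    pbs_equation 3 2 (Beam ∘ (Gate U ⊗ Gate U)) ((Gate U ⊗ Gate U) ∘ Beam)
| pbs_eq4 U V :
    pbs_equation 4 1
      (Tr ((Wire ⊗ Gate V) ∘ Beam ∘ (Wire ⊗ Gate U) ∘ Beam))
      (Tr ((Wire ⊗ Gate U) ∘ Beam))
| pbs_eq5 :
    pbs_equation 5 2 ((Neg ⊗ Neg) ∘ Beam ∘ (Neg ⊗ Neg)) (Swap ∘ Beam)
| pbs_eq6 U V : pbs_equation 6 1 (Gate V ∘ Gate U) (Gate (V *m U)%R)
| pbs_eq7 U : pbs_equation 7 0 (Tr (Gate U)) Empty
| pbs_eq8 : pbs_equation 8 2 (Beam ∘ Beam) (Wire ⊗ Wire)
| pbs_eq9 :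
    pbs_equation 9 3
      ((Beam ⊗ Wire) ∘ (Wire ⊗ Beam) ∘ (Beam ⊗ Wire))
      ((Swap ⊗ Wire) ∘ (Wire ⊗ Beam) ∘ (Swap ⊗ Wire))
| pbs_eq10 :
    pbs_equation 10 2
      (Beam ∘ (Neg ⊗ Wire) ∘ Beam)
      ((Neg ⊗ Wire) ∘ Beam ∘ (Neg ⊗ Wire)).

(* The smallest congruence containing the structural congruence and all
   instances of the equations (j), j <> i. *)
Definition pbs_without (i : nat) : typed_rel :=
  congruence_closure (fun n D D' =>
    structural_congruence n D D' \/
    exists2 j : nat, j <> i & pbs_equation j n D D').

End Congruences.

(* Main.v *)
Require Import Defs.
From mathcomp Require Import all_boot all_order all_algebra.
From mathcomp Require Import reals complex.

(** For each equation we exhibit a congruence containing the structural one and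
    the nine other equations, but not that equation.

    Four of them are syntactic, because the structural congruence preserves the
    numbers of negations and beam splitters: the parity of the total number of
    negations and beam splitters separates (4), the presence of a negation (5),
    the presence of a beam splitter (8), and the parity of the number of
    negations (10).

    The six others are models in sets and relations, where n wires carry a
    sequence of n letters of an alphabet A and the trace is existential
    quantification. Over the empty alphabet all terms of type n -> n with
    n >= 1 are equal, but [Tr (Gate U)] is the empty relation whereas [Empty]
    is not; this separates (7). For the rest a letter is a pair of bits, one
    for each polarisation; the negation exchanges the two bits of a wire and
    the beam splitter exchanges the first bits of its wires. A gate is a test,
    i.e. a restriction of the identity: [00] for all gates (1), or for all but
    the identity gate (6); "the first bit is 0" (2) or "the two bits are equal"
    (3) for singular gates. For (9) the gates are trivial, and the beam
    splitter exchanges the second bits when the four bits have an odd sum. *)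

Set Implicit Arguments.
Unset Strict Implicit.
Unset Printing Implicit Defensive.

Import GRing.Theory Num.Theory.

Local Open Scope pbs_scope.

Section Independence.
Variables (R : realType) (q : nat).
Local Notation term := (term R q).

(** * Separating congruences *)

Definition pbs_independent (i : nat) : Prop :=
  ~ (forall n (D D' : term), pbs_equation i n D D' -> pbs_without i n D D').

(** Typing is dropped: the invariants below make sense on raw terms, and such a relation still
    bounds the typed closure from above. *)
Record congruence (F : term -> term -> Prop) : Prop := Congruence {
  congr_refl D : F D D;
  congr_sym D D' : F D D' -> F D' D;
  congr_trans D D' D'' : F D D' -> F D' D'' -> F D D'';
  congr_Seq D2 D2' D1 D1' : F D2 D2' -> F D1 D1' -> F (D2 ∘ D1) (D2' ∘ D1');
  congr_Par D1 D1' D2 D2' : F D1 D1' -> F D2 D2' -> F (D1 ⊗ D2) (D1' ⊗ D2');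
  congr_Tr D D' : F D D' -> F (Tr D) (Tr D')
}.

Lemma congruence_closure_min (F : term -> term -> Prop) (E : typed_rel R q) :
  congruence F -> (forall n D D', E n D D' -> F D D') ->
  forall n D D', congruence_closure E n D D' -> F D D'.
Proof.
move=> [Frefl Fsym Ftrans FSeq FPar FTr] EF n D D'.
by elim=> {n D D'} *; eauto.
Qed.

Lemma independent_of_congruence (F : term -> term -> Prop) i :
  congruence F ->
  (forall n D D', structural_axiom n D D' -> F D D') ->
  (forall j n D D', j <> i -> pbs_equation j n D D' -> F D D') ->
  (exists n D D', pbs_equation i n D D' /\ ~ F D D') ->
  pbs_independent i.
Proof.
move=> congrF Fstruct Feq [n [D [D' [eqD nF]]]] derivable.
apply/nF/(congruence_closure_min congrF _ (derivable _ _ _ eqD)).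
move=> m D1 D2 [|[j]]; last exact: Feq.
exact: (congruence_closure_min congrF Fstruct).
Qed.

(** * Syntactic invariants in a commutative monoid *)

Section Weight.
Variables (op : Monoid.com_law false) (wNeg wBeam : bool).

(** With [addb] this is a parity of occurrences, with [orb] a presence. *)
Fixpoint weight (D : term) : bool :=
  match D with
  | Neg => wNeg
  | Beam => wBeam
  | D2 ∘ D1 => op (weight D2) (weight D1)
  | D1 ⊗ D2 => op (weight D1) (weight D2)
  | Tr D => weight D
  | _ => false
  end.

Lemma weight_idn k : weight (idn R q k) = false.
Proof. by elim: k => //= k ->; rewrite Monoid.mul1m. Qed.

Lemma weight_swap1 k : weight (swap1 R q k) = false.
Proof. by elim: k => //= k ->; rewrite weight_idn !Monoid.mul1m. Qed.

Lemma weight_trn k D : weight (trn k D) = weight D.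
Proof. by elim: k. Qed.

(** Up to order, the two sides of a structural axiom differ only by wires and swaps, whose weight is
    the unit. *)
Lemma weight_structural n D D' :
  structural_axiom n D D' -> weight D = weight D'.
Proof.
case=> {n D D'} *;
  rewrite ?weight_trn /= ?weight_trn ?weight_swap1 ?weight_idn /=;
  rewrite ?Monoid.mul1m ?Monoid.mulm1 //.
- by rewrite Monoid.mulmA.
- by rewrite Monoid.mulmA.
- by rewrite Monoid.mulmACA.
- by rewrite Monoid.mulmC.
Qed.

Lemma weight_congruence : congruence (fun D D' => weight D = weight D').
Proof. by split=> //= *; congruence. Qed.

Lemma weight_independent i :
  (forall j n D D', j <> i -> pbs_equation j n D D' -> weight D = weight D') ->
  (exists n D D', pbs_equation i n D D' /\ weight D <> weight D') ->
  pbs_independent i.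
Proof.
exact: independent_of_congruence weight_congruence weight_structural.
Qed.

End Weight.

(** The total drops from 2 to 1 in (4), but changes by an even number elsewhere: 5 against 1 in (5),
    2 against 0 in (8), 3 against 1 in (9). *)
Lemma eq4_independent : pbs_independent 4.
Proof.
apply: (@weight_independent addb true true) => [j n D D' ji eqD|].
  by case: eqD ji.
by exists 1%N; do 2!eexists; split; [apply: (pbs_eq4 1%:M 1%:M)|].
Qed.

Lemma eq5_independent : pbs_independent 5.
Proof.
apply: (@weight_independent orb true false) => [j n D D' ji eqD|].
  by case: eqD ji.
by exists 2%N; do 2!eexists; split; [exact: pbs_eq5|].
Qed.

Lemma eq8_independent : pbs_independent 8.
Proof.
apply: (@weight_independent orb false true) => [j n D D' ji eqD|].
  by case: eqD ji.
by exists 2%N; do 2!eexists; split; [exact: pbs_eq8|].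
Qed.

Lemma eq10_independent : pbs_independent 10.
Proof.
apply: (@weight_independent addb true false) => [j n D D' ji eqD|].
  by case: eqD ji.
by exists 2%N; do 2!eexists; split; [exact: pbs_eq10|].
Qed.

(** * Relational semantics of terms *)

Section Relational.
Variables (A : Type) (neg : A -> A) (beam : A -> A -> A * A).
Variable gate : 'M[complex R]_q -> A -> bool.

(** Lists of any length fit raw terms; [rel_size] recovers the lengths from typing. The traced wire
    is the last one, hence [rcons]. *)
Fixpoint rel (D : term) (x y : seq A) : Prop :=
  match D with
  | Empty => x = [::] /\ y = [::]
  | Wire => exists a, x = [:: a] /\ y = [:: a]
  | Neg => exists a, x = [:: a] /\ y = [:: neg a]
  | Swap => exists a b, x = [:: a; b] /\ y = [:: b; a]
  | Beam => exists a b, x = [:: a; b] /\ y = [:: (beam a b).1; (beam a b).2]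
  | Gate U => exists a, [/\ gate U a, x = [:: a] & y = [:: a]]
  | D2 ∘ D1 => exists z, rel D1 x z /\ rel D2 z y
  | D1 ⊗ D2 => exists x1 x2 y1 y2,
      [/\ x = x1 ++ x2, y = y1 ++ y2, rel D1 x1 y1 & rel D2 x2 y2]
  | Tr D => exists a, rel D (rcons x a) (rcons y a)
  end.

Definition rel_equiv (D D' : term) : Prop :=
  forall x y, rel D x y <-> rel D' x y.

Lemma cat_inj (s1 s2 t1 t2 : seq A) :
  size s1 = size t1 -> s1 ++ s2 = t1 ++ t2 -> s1 = t1 /\ s2 = t2.
Proof.
elim: s1 t1 => [|a s IH] [|b t] //= [/IH{}IH] [-> /IH[-> ->]].
by [].
Qed.

Lemma rel_size D n x y : typed D n -> rel D x y -> size x = n /\ size y = n.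
Proof.
move=> tD; elim: tD x y => {n D}
  [|||||U|n D2 D1 _ IH2 _ IH1|n m D1 D2 _ IH1 _ IH2|n D _ IH] x y /=.
- by case=> -> ->.
- by case=> a [-> ->].
- by case=> a [-> ->].
- by case=> a [b [-> ->]].
- by case=> a [b [-> ->]].
- by case=> a [_ -> ->].
- by case=> z [/IH1[? ?] /IH2[? ?]].
- case=> x1 [x2 [y1 [y2 [-> -> /IH1[? ?] /IH2[? ?]]]]].
  by rewrite !size_cat; split; congr addn.
- by case=> a /IH; rewrite !size_rcons => -[[->] [->]].
Qed.

Lemma rel_idn k x y : rel (idn R q k) x y <-> x = y /\ size x = k.
Proof.
elim: k x y => [|k IH] x y /=.
  by split=> [[-> ->]|[<- /size0nil ->]].
split=> [[x1 [x2 [y1 [y2 [-> -> /IH[-> <-] [a [-> ->]]]]]]]|[<-]].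
  by rewrite size_cat addn1.
case/lastP: x => // x a; rewrite size_rcons => -[sx].
exists x, [:: a], x, [:: a]; rewrite -cats1; split=> //; first exact/IH.
by exists a.
Qed.

Lemma rel_swap1 k x y :
  rel (swap1 R q k) x y <->
  exists a s, [/\ size s = k, x = a :: s & y = rcons s a].
Proof.
elim: k x y => [|k IH] x y /=.
  split=> [[a [-> ->]]|[a [s [/size0nil -> -> ->]]]]; last by exists a.
  by exists a, [::].
split.
- case=> z [[x1 [x2 [z1 [z2 [-> -> /IH[a [s [sk -> ->]]] [b [-> ->]]]]]]]].
  case=> u1 [u2 [v1 [v2 [eu -> /rel_idn[<- su] [c [d [eu2 ->]]]]]]].
  move: eu; rewrite {}eu2 -cats1 -catA.
  case/cat_inj=> [|<- [<- <-]]; first by rewrite sk su.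
  exists a, (rcons s b); rewrite size_rcons sk /= cats1.
  by split=> //; rewrite -!cats1 -catA.
- case=> a [s [+ -> ->]]; case/lastP: s => // s b; rewrite size_rcons => -[sk].
  exists (s ++ [:: a; b]); split.
    exists (a :: s), [:: b], (rcons s a), [:: b].
    rewrite -!cats1 -catA; split=> //; last by exists b.
    by apply/IH; exists a, s; rewrite cats1.
  exists s, [:: a; b], s, [:: b; a]; split=> //.
  + by rewrite -!cats1 -catA.
  + exact/rel_idn.
  + by exists a, b.
Qed.

Lemma rel_trn k D x y :
  rel (trn k D) x y <-> exists z, size z = k /\ rel D (x ++ z) (y ++ z).
Proof.
elim: k x y => [|k IH] x y /=.
  split=> [xy|[z [/size0nil ->]]]; last by rewrite !cats0.
  by exists [::]; rewrite !cats0.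
(* The outermost trace binds the first of the traced letters. *)
split=> [[a /IH[z [<- xy]]]|[[|a z] [] // [sz] xy]].
  by exists (a :: z); rewrite -!cat_rcons.
by exists a; apply/IH; exists z; rewrite !cat_rcons.
Qed.

Lemma rel_congruence : congruence rel_equiv.
Proof.
split.
- by [].
- by move=> D D' e x y; split=> /e.
- by move=> D D' D'' e e' x y; split=> [/e/e'|/e'/e].
- move=> D2 D2' D1 D1' e2 e1 x y.
  by split=> -[z [/e1 ? /e2 ?]]; exists z.
- move=> D1 D1' D2 D2' e1 e2 x y.
  split=> -[x1 [x2 [y1 [y2 [? ? /e1 ? /e2 ?]]]]];
    by exists x1, x2, y1, y2.
- by move=> D D' e x y; split=> -[a /e ?]; exists a.
Qed.

Lemma rel_superposing n m D1 D2 :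
  typed D1 n -> typed D2 m.+1 -> rel_equiv (Tr (D1 ⊗ D2)) (D1 ⊗ Tr D2).
Proof.
move=> t1 t2 x y; split=> /=.
- case=> a [x1 [x2 [y1 [y2 [ex ey r1 r2]]]]].
  have [sx sy] := rel_size t2 r2.
  (* [D2] has at least one wire, so the traced letter lies in its part of the list. *)
  case/lastP: x2 sx ex r2 => // x2 b _; rewrite -rcons_cat => /rcons_inj[-> <-].
  case/lastP: y2 sy ey => // y2 c _; rewrite -rcons_cat => /rcons_inj[-> <-].
  by move=> r2; exists x1, x2, y1, y2; split=> //; exists a.
- case=> x1 [x2 [y1 [y2 [-> -> r1 [a r2]]]]]; exists a.
  by exists x1, (rcons x2 a), y1, (rcons y2 a); rewrite !rcons_cat.
Qed.

Lemma rel_tightening_r D1 D2 : rel_equiv (Tr (D2 ∘ (D1 ⊗ Wire))) (Tr D2 ∘ D1).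
Proof.
move=> x y; split=> /=.
- case=> a [z [[x1 [x2 [z1 [z2 [ex -> r1 [b [ex2 ->]]]]]]] r2]].
  move: ex r2; rewrite {}ex2 !cats1 => /rcons_inj[-> <-] r2.
  by exists z1; split=> //; exists a.
- case=> z [r1 [a r2]]; exists a, (rcons z a); split=> //.
  by exists x, [:: a], z, [:: a]; rewrite !cats1; split=> //; exists a.
Qed.

Lemma rel_tightening_l D1 D2 : rel_equiv (Tr ((D2 ⊗ Wire) ∘ D1)) (D2 ∘ Tr D1).
Proof.
move=> x y; split=> /=.
- case=> a [z [r1 [z1 [z2 [y1 [y2 [ez ey r2 [b [ez2 ey2]]]]]]]]].
  move: ez ey r1; rewrite {}ez2 {}ey2 !cats1 => -> /rcons_inj[-> <-] r1.
  by exists z1; split=> //; exists a.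
- case=> z [[a r1] r2]; exists a, (rcons z a); split=> //.
  by exists z, [:: a], y, [:: a]; rewrite !cats1; split=> //; exists a.
Qed.

(** The loop is cut on the other side of [D2]: the new witness [w2] is the value at the opposite end
    of [D2]. *)
Lemma rel_sliding n k D1 D2 :
  typed D1 (n + k) -> typed D2 k ->
  rel_equiv (trn k ((idn R q n ⊗ D2) ∘ D1)) (trn k (D1 ∘ (idn R q n ⊗ D2))).
Proof.
move=> t1 t2 x y; split=> /rel_trn[z [sz /=]].
- case=> w [r1 [w1 [w2 [y1 [y2 [ew ey /rel_idn[ewy sw] r2]]]]]].
  have [sw2 sy2] := rel_size t2 r2.
  have [sx sw'] := rel_size t1 r1.
  subst w1 w.
  have [ey1 ey2] : y = y1 /\ z = y2.
    apply: cat_inj (ey); move: (congr1 size ey).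
    by rewrite !size_cat sz sy2 => /addIn.
  subst y1 y2.
  apply/rel_trn; exists w2; split=> //=; exists (x ++ z); split=> //.
  exists x, w2, x, z; split=> //; apply/rel_idn; split=> //.
  by move: sx; rewrite size_cat sz => /addIn.
- case=> w [[x1 [x2 [w1 [w2 [ex ew /rel_idn[exw sx1] r2]]]]] r1].
  have [sx2 sw2] := rel_size t2 r2.
  have [sw sy] := rel_size t1 r1.
  subst w1 w.
  have [ex1 ex2] : x = x1 /\ z = x2.
    apply: cat_inj (ex); move: (congr1 size ex).
    by rewrite !size_cat sz sx2 => /addIn.
  subst x1 x2.
  apply/rel_trn; exists w2; split=> //=; exists (y ++ z); split=> //.
  exists y, z, y, w2; split=> //; apply/rel_idn; split=> //.
  by move: sy; rewrite size_cat sz => /addIn.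
Qed.

Lemma rel_structural n D D' : structural_axiom n D D' -> rel_equiv D D'.
Proof.
case=> {n D D'}.
- move=> n D1 D2 D3 _ _ _ x y; split=> /=.
    by case=> z [? [w [? ?]]]; exists w; split=> //; exists z.
  by case=> w [[z [? ?]] ?]; exists z; split=> //; exists w.
- move=> k D tD x y; split=> /= [[z [? /rel_idn[<- _]]]|r] //.
  exists y; split=> //; apply/rel_idn; split=> //.
  by case: (rel_size tD r).
- move=> k D tD x y; split=> /= [r|[z [/rel_idn[<- _]]]] //.
  exists x; split=> //; apply/rel_idn; split=> //.
  by case: (rel_size tD r).
- move=> n D _ x y; split=> /=.
    by case=> x1 [x2 [y1 [y2 [-> -> [-> ->]]]]].
  by exists [::], x, [::], y.
- move=> n D _ x y; split=> /=.
    by exists x, [::], y, [::]; rewrite !cats0.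
  by case=> x1 [x2 [y1 [y2 [-> -> r [-> ->]]]]]; rewrite !cats0.
- move=> n m p D1 D2 D3 _ _ _ x y; split=> /=.
    case=> _ [x3 [_ [y3 [-> -> [x1 [x2 [y1 [y2 [-> -> ? ?]]]]] ?]]]].
    exists x1, (x2 ++ x3), y1, (y2 ++ y3); rewrite !catA; split=> //.
    by exists x2, x3, y2, y3.
  case=> x1 [_ [y1 [_ [-> -> ? [x2 [x3 [y2 [y3 [-> -> ? ?]]]]]]]]].
  exists (x1 ++ x2), x3, (y1 ++ y2), y3; rewrite !catA; split=> //.
  by exists x1, x2, y1, y2.
- move=> n m D1 D2 D3 D4 t1 t3 t2 t4 x y; split=> /=.
    case=> x1 [x2 [y1 [y2 [-> -> [z1 [? ?]] [z2 [? ?]]]]]].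
    exists (z1 ++ z2); split; first by exists x1, x2, z1, z2.
    by exists z1, z2, y1, y2.
  case=> z [[x1 [x2 [z1 [z2 [-> -> r1 r2]]]]]].
  (* Both splittings of the middle list occur at the common arity of [D1] and [D3], so they
     agree. *)
  case=> u1 [u2 [y1 [y2 [+ -> r3 r4]]]] => /cat_inj[|e1 e2].
    by rewrite (proj2 (rel_size t1 r1)) (proj1 (rel_size t3 r3)).
  subst u1 u2; exists x1, x2, y1, y2; split=> //; first by exists z1.
  by exists z2.
- move=> k D tD x y; split=> /=.
    case=> z [[x1 [x2 [z1 [z2 [-> -> [a [-> ->]] r]]]]]].
    case/rel_swap1=> _ [_ [_ [<- <-] ->]].
    have [sx _] := rel_size tD r.
    exists (rcons x2 a); split; first by apply/rel_swap1; exists a, x2.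
    by exists x2, [:: a], z2, [:: a]; rewrite !cats1; split=> //; exists a.
  case=> z [/rel_swap1[a [s [sk -> ->]]] [u1 [u2 [y1 [y2 [+ -> r]]]]]].
  move=> + [b [eu ->]]; rewrite eu !cats1 => /rcons_inj[es <-]; subst u1.
  have [_ sy] := rel_size tD r.
  exists (a :: y1); split; last by apply/rel_swap1; exists a, y1.
  by exists [:: a], s, [:: a], y1; split=> //; exists a.
- move=> x y; split.
    by case=> z [[a [b [-> ->]]] [_ [_ [[<- <-] ->]]]]; apply/(@rel_idn 2).
  case/(@rel_idn 2)=> <-; case: x => [|a [|b []]] // _.
  by exists [:: b; a]; split; [exists a, b|exists b, a].
- by move=> n m D1 D2; apply: rel_superposing.
- by move=> n D1 D2 _ _; apply: rel_tightening_r.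
- by move=> n D1 D2 _ _; apply: rel_tightening_l.
- by move=> n k D1 D2; apply: rel_sliding.
- move=> x y; split=> /=.
    case=> a [b [c []]]; rewrite -!cats1.
    case: x => [|x [|? []]] //= [-> ->]; case: y => [|y [|? []]] //= [-> <-].
    by exists c.
  by case=> a [-> ->]; exists a, a, a.
Qed.

Lemma rel_independent i :
  (forall j n D D', j <> i -> pbs_equation j n D D' -> rel_equiv D D') ->
  (exists n D D', pbs_equation i n D D' /\ ~ rel_equiv D D') ->
  pbs_independent i.
Proof. exact: independent_of_congruence rel_congruence rel_structural. Qed.

(** * Evaluation of trace-free terms *)

Fixpoint arity (D : term) : nat :=
  match D with
  | Empty => 0
  | Swap | Beam => 2
  | D2 ∘ D1 => arity D1
  | D1 ⊗ D2 => arity D1 + arity D2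
  | Tr D => (arity D).-1
  | _ => 1
  end.

(** A Boolean certificate of being trace-free and well typed, to be checked by computation. *)
Fixpoint plain (D : term) : bool :=
  match D with
  | D2 ∘ D1 => [&& plain D2, plain D1 & arity D2 == arity D1]
  | D1 ⊗ D2 => plain D1 && plain D2
  | Tr _ => false
  | _ => true
  end.

Lemma plain_typed D : plain D -> typed D (arity D).
Proof.
elim: D => [|||||U|D2 IH2 D1 IH1|D1 IH1 D2 IH2|] //=; try by constructor.
- by case/and3P=> /IH2 + /IH1 ? /eqP e; rewrite e; constructor.
- by case/andP=> /IH1 ? /IH2 ?; constructor.
Qed.

(* On trace-free terms, [rel] is the graph of a partial function, which makes
   the equations checkable by enumeration over a finite alphabet. *)
Fixpoint run (D : term) (x : seq A) : option (seq A) :=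
  match D with
  | Empty => if x is [::] then Some [::] else None
  | Wire => if x is [:: a] then Some [:: a] else None
  | Neg => if x is [:: a] then Some [:: neg a] else None
  | Swap => if x is [:: a; b] then Some [:: b; a] else None
  | Beam =>
      if x is [:: a; b] then Some [:: (beam a b).1; (beam a b).2] else None
  | Gate U => if x is [:: a] then if gate U a then Some [:: a] else None
              else None
  | D2 ∘ D1 => if run D1 x is Some z then run D2 z else None
  | D1 ⊗ D2 =>
      if run D1 (take (arity D1) x) is Some y1 then
        if run D2 (drop (arity D1) x) is Some y2 then Some (y1 ++ y2) else None
      else None
  | Tr _ => None
  end.

Lemma rel_runE D x y : plain D -> rel D x y <-> run D x = Some y.
Proof.
elim: D x y => [|||||U|D2 IH2 D1 IH1|D1 IH1 D2 IH2|] x y //=.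
- by move=> _; split=> [[-> ->]|] //; case: x => // -[<-].
- by move=> _; split=> [[a [-> ->]]|] //; case: x => [|a []] // [<-]; exists a.
- by move=> _; split=> [[a [-> ->]]|] //; case: x => [|a []] // [<-]; exists a.
- move=> _; split=> [[a [b [-> ->]]]|] //.
  by case: x => [|a [|b []]] // [<-]; exists a, b.
- move=> _; split=> [[a [b [-> ->]]]|] //.
  by case: x => [|a [|b []]] // [<-]; exists a, b.
- move=> _; split=> [[a [ga -> ->]]|]; first by rewrite ga.
  by case: x => [|a []] //; case: ifP => // ga [<-]; exists a.
- case/and3P=> p2 p1 _.
  split=> [[z [/(IH1 _ _ p1)-> /(IH2 _ _ p2)]]|] //.
  case e1: run => [z|] // e2; exists z.
  by split; [apply/IH1|apply/IH2].
- case/andP=> p1 p2; split.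
    case=> x1 [x2 [y1 [y2 [-> -> r1 r2]]]].
    have [<- _] := rel_size (plain_typed p1) r1.
    rewrite take_size_cat // drop_size_cat //.
    by rewrite (proj1 (IH1 _ _ p1) r1) (proj1 (IH2 _ _ p2) r2).
  case e1: run => [y1|] //; case e2: run => [y2|] // -[<-].
  exists (take (arity D1) x), (drop (arity D1) x), y1, y2.
  by rewrite cat_take_drop; split=> //; [apply/IH1|apply/IH2].
Qed.

(** By typing, both relations are empty on inputs of any other length. *)
Lemma rel_equiv_run n D D' :
  [&& plain D, plain D', arity D == n & arity D' == n] ->
  rel_equiv D D' <-> (forall x, size x = n -> run D x = run D' x).
Proof.
case/and4P=> p p' /eqP ar /eqP ar'.
split=> [e x sx|e x y].
  case e1: (run D x) => [y|].
    by apply/esym/(rel_runE _ _ p')/e/(rel_runE _ _ p).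
  case e2: (run D' x) => [y|] //.
  by move/(rel_runE _ _ p'): e2 => /e/(rel_runE _ _ p); rewrite e1.
split=> r.
  have [sx _] := rel_size (plain_typed p) r.
  by apply/(rel_runE _ _ p'); rewrite -e ?sx //; apply/(rel_runE _ _ p).
have [sx _] := rel_size (plain_typed p') r.
by apply/(rel_runE _ _ p); rewrite e ?sx //; apply/(rel_runE _ _ p').
Qed.

Lemma rel_Tr_run D x y :
  plain D -> rel (Tr D) x y <-> exists a, run D (rcons x a) = Some (rcons y a).
Proof. by move=> p; split=> -[a] /(rel_runE _ _ p) r; exists a. Qed.

(** * Equations with gates as conditions on the model *)

Lemma rel_eq1 : rel_equiv Wire (Gate 1%:M) <-> forall a, gate 1%:M a.
Proof.
rewrite (@rel_equiv_run 1) //; split=> [e a|e [|a []] //= _]; last by rewrite e.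
by have /= := e [:: a] erefl; case: ifP.
Qed.

Lemma rel_eq2 U :
  rel_equiv (Gate U ∘ Neg) (Neg ∘ Gate U) <->
  forall a, gate U (neg a) = gate U a.
Proof.
rewrite (@rel_equiv_run 1) //; split=> [e a|e [|a []] //= _].
  by have := e [:: a] erefl => /=; do 2!case: (gate U _).
by rewrite e; case: ifP.
Qed.

Lemma rel_eq3 U :
  rel_equiv (Beam ∘ (Gate U ⊗ Gate U)) ((Gate U ⊗ Gate U) ∘ Beam) <->
  forall a b, gate U a && gate U b =
    gate U (beam a b).1 && gate U (beam a b).2.
Proof.
rewrite (@rel_equiv_run 2) //; split=> [e a b|e [|a [|b []]] //= _].
  by have := e [:: a; b] erefl => /=; do 4!case: (gate U _).
by have := e a b; do 4!case: (gate U _).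
Qed.

(** Here [a] and [c] are the input and output letters and [b] is the letter on the loop. *)
Lemma rel_eq4 U V :
  (forall a c,
    (exists b,
      gate U (beam a b).2 && gate V (beam (beam a b).1 (beam a b).2).2 /\
      beam (beam a b).1 (beam a b).2 = (c, b)) <->
    (exists b, gate U (beam a b).2 /\ beam a b = (c, b))) ->
  rel_equiv (Tr ((Wire ⊗ Gate V) ∘ Beam ∘ (Wire ⊗ Gate U) ∘ Beam))
    (Tr ((Wire ⊗ Gate U) ∘ Beam)).
Proof.
move=> e x y; rewrite !rel_Tr_run //.
case: x y => [|a [|? [|? ?]]] [|c [|? [|? ?]]];
  try by (split=> -[b] /=; do ?case: ifP).
split=> [[b /=]|[b /=]].
  case: ifP => //= gU; case: ifP => //= gV [e1 e2].
  have [|b' [gU' e']] := proj1 (e a c).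
    by exists b; rewrite gU gV [beam _ (beam _ _).2]surjective_pairing e1 e2.
  by exists b'; rewrite gU' e'.
case: ifP => //= gU [e1 e2].
have [|b' [/andP[gU' gV'] e']] := proj2 (e a c).
  by exists b; rewrite gU [beam _ _]surjective_pairing e1 e2.
by exists b'; rewrite gU' /= gV' e'.
Qed.

Lemma rel_eq6 U V :
  rel_equiv (Gate V ∘ Gate U) (Gate (V *m U)%R) <->
  forall a, gate V a && gate U a = gate (V *m U)%R a.
Proof.
rewrite (@rel_equiv_run 1) //; split=> [e a|e [|a []] //= _].
  by have := e [:: a] erefl => /=; do 3!case: (gate _ a).
by rewrite -e; case: (gate U a); case: (gate V a).
Qed.

Lemma rel_eq7 U : rel_equiv (Tr (Gate U)) Empty <-> exists a, gate U a.
Proof.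
split=> [e|[a ga] x y /=].
  by have [a [b [gb _ _]]] := proj2 (e [::] [::]) (conj erefl erefl); exists b.
split=> [[b [c []]]|[-> ->]]; last by exists a, a.
by case: x => [|? []] //; case: y => [|? []].
Qed.

End Relational.

(** * The separating models *)

Lemma eq7_independent : pbs_independent 7.
Proof.
apply: (@rel_independent void id pair (fun _ _ => true)) => [j n D D' ji eqD|].
  (* The other equations have type at least 1, and no list over [void] has positive length. *)
  case: eqD ji => {j n D D'} [|U|U|U V||U V|U|||] //= _;
    [| | |by apply: rel_eq4; case| | | | |];
    by apply/rel_equiv_run; first exact/and4P; case=> [|[]].
exists 0%N; do 2!eexists; split; first exact: (pbs_eq7 0).
by move/rel_eq7=> [[]].
Qed.

Local Notation bit2 := (bool * bool)%type.

Definition flip (a : bit2) : bit2 := (a.2, a.1).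
Definition swap_fst (a b : bit2) : bit2 * bit2 := ((b.1, a.2), (a.1, b.2)).
(** Both [swap_fst] followed by a swap and its conjugate by negations, as (5) requires. *)
Definition swap_snd (a b : bit2) : bit2 * bit2 := ((a.1, b.2), (b.1, a.2)).
(* On two wires this is a conjugate of [swap_fst] by a permutation commuting with
   negations and swaps, hence (5), (8) and (10) still hold. *)
Definition swap_parity (a b : bit2) : bit2 * bit2 :=
  if a.1 (+) a.2 (+) b.1 (+) b.2 then swap_snd a b else swap_fst a b.

Lemma swap_parityK a b :
  swap_parity (swap_parity a b).1 (swap_parity a b).2 = (a, b).
Proof. by case: a b => [[] []] [[] []]. Qed.

Lemma swap_fst_gate_free gate j n D D' :
  j \in [:: 5; 8; 9; 10] -> pbs_equation j n D D' ->
  rel_equiv flip swap_fst gate D D'.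
Proof.
move=> + eqD; case: eqD => // _; apply/rel_equiv_run; try exact/and4P.
- by case=> [|[[] []] [|[[] []] []]].
- by case=> [|[[] []] [|[[] []] []]].
- by case=> [|[[] []] [|[[] []] [|[[] []] []]]].
- by case=> [|[[] []] [|[[] []] []]].
Qed.

Lemma swap_parity_gate_free gate j n D D' :
  j \in [:: 5; 8; 10] -> pbs_equation j n D D' ->
  rel_equiv flip swap_parity gate D D'.
Proof.
move=> + eqD; case: eqD => // _; apply/rel_equiv_run; try exact/and4P;
  by case=> [|[[] []] [|[[] []] []]].
Qed.

Lemma eq9_independent : pbs_independent 9.
Proof.
apply: (@rel_independent _ flip swap_parity (fun _ _ => true))
  => [j n D D' ji eqD|].
  case: (boolP (j \in [:: 5; 8; 10])) => [j_free|].
    exact: swap_parity_gate_free eqD.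
  case: eqD ji => {j n D D'} [|U|U|U V||U V|U|||] // _ _.
  - exact/rel_eq1.
  - exact/rel_eq2.
  - exact/rel_eq3.
  (* As [swap_parity] is an involution, the left side forces [c = a]; on the right the loop letter
     [a] works, since [swap_parity a a = (a, a)]. *)
  - apply: rel_eq4 => a c; split=> -[b [_]].
      rewrite swap_parityK => -[<-]; exists a; split=> //.
      by case: (a) => [[] []].
    move=> ac; exists b; rewrite swap_parityK; split=> //; congr pair.
    by case: a b c ac => [[] []] [[] []] [[] []].
  - exact/rel_eq6.
  - by apply/rel_eq7; exists (false, false).
exists 3%N; do 2!eexists; split; first exact: pbs_eq9.
move/rel_equiv_run => /(_ 3 erefl).
(* Writing letters as bit pairs, the left side sends 10,01,00 to 01,00,10, while the right side
   fixes it. *)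
by move=> /(_ [:: (true, false); (false, true); (false, false)] erefl).
Qed.

(** Gates with [c U] act as identities, all others as the test [T]. Multiplicativity of [c] gives
    (6), and a letter passing [T] passes every gate, which gives (7). *)
Lemma test_independent i (c : 'M[complex R]_q -> bool) (T : bit2 -> bool) :
  (exists a, T a) ->
  (i <> 1 -> c 1%:M%R) ->
  (i <> 2 -> forall a, T (flip a) = T a) ->
  (i <> 3 -> forall a b,
     T a && T b = T (swap_fst a b).1 && T (swap_fst a b).2) ->
  (i <> 6 -> forall U V, c (V *m U)%R = c V && c U) ->
  (exists n D D', pbs_equation i n D D' /\
     ~ rel_equiv flip swap_fst (fun U a => c U || T a) D D') ->
  pbs_independent i.
Proof.
move=> [[h0 v0] T0] c1 T2 T3 c6 nF.
apply: rel_independent nF => j n D D' ji eqD.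
case: (boolP (j \in [:: 5; 8; 9; 10])) => [j_free|].
  exact: swap_fst_gate_free eqD.
case: eqD ji => {j n D D'} [|U|U|U V||U V|U|||] // ji _.
- by apply/rel_eq1 => a; rewrite c1 // => e; apply: ji.
- by apply/rel_eq2 => a; rewrite T2 // => e; apply: ji.
- by apply/rel_eq3 => a b; case: (c U) => //=; apply: T3 => e; apply: ji.
- apply: rel_eq4 => -[h v] c'; rewrite /swap_fst /=.
  split=> [[[k w] [/andP[Uhw _] [<- ]]]|[[k w] [Uhw [<- <-]]]].
    by exists (h, w).
  (* The loop letter must pass [V]. If [U] is the identity, a letter passing [T] serves; otherwise
     [(h, w)] itself passes [T], hence [V]. *)
  have [cU|ncU] := boolP (c U).
    by exists (h0, v0); rewrite /= T0 orbT.
  exists (h, w); move: Uhw; rewrite /= (negbTE ncU) /= => ->.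
  by rewrite orbT.
- apply/rel_eq6 => a; rewrite c6 => [|e]; last exact: ji.
  by case: (c V); case: (c U); case: (T a).
- by apply/rel_eq7; exists (h0, v0); rewrite T0 orbT.
Qed.

Lemma eq1_independent : pbs_independent 1.
Proof.
apply: (@test_independent 1 xpred0 (fun a => ~~ a.1 && ~~ a.2)) => //.
- by exists (false, false).
- by move=> _ [[] []].
- by move=> _ [[] []] [[] []].
- exists 1%N; do 2!eexists; split; first exact: pbs_eq1.
  by move/rel_eq1/(_ (true, true)).
Qed.

Lemma eq6_independent : (0 < q)%N -> pbs_independent 6.
Proof.
move=> q_gt0.
apply: (@test_independent 6 (pred1 1%:M%R) (fun a => ~~ a.1 && ~~ a.2)) => //.
- by exists (false, false).
- by move=> _; exact: eqxx.
- by move=> _ [[] []].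
- by move=> _ [[] []] [[] []].
- pose two : complex R := 2%:R%R.
  exists 1%N; do 2!eexists; split.
    (* The product is the identity, which accepts every letter, but [two%:M] is a proper test
       rejecting [(true, true)]. *)
    exact: (pbs_eq6 two%:M%R (two^-1)%:M%R).
  have two_neq1 : (two%:M != 1%:M :> 'M_q)%R.
    apply/eqP => /matrixP/(_ (Ordinal q_gt0) (Ordinal q_gt0)).
    by rewrite !mxE eqxx /= => /eqP; rewrite eqr_nat.
  move/rel_eq6/(_ (true, true)).
  by rewrite -scalar_mxM mulVf ?pnatr_eq0 //= eqxx (negbTE two_neq1) !andbF.
Qed.

Lemma unitmx0 (F : fieldType) m :
  (0 < m)%N -> ((0%R : 'M[F]_m) \in unitmx) = false.
Proof. by case: m => // m _; rewrite unitmxE det0 unitr0. Qed.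

(** Invertibility is multiplicative, and the zero matrix is singular as [q > 0]. The beam splitter
    only permutes first bits, so it respects the test; the negation does not. *)
Lemma eq2_independent : (0 < q)%N -> pbs_independent 2.
Proof.
move=> q_gt0.
apply: (@test_independent 2 (mem unitmx) (fun a => ~~ a.1)) => //.
- by exists (false, false).
- by move=> _; exact: unitmx1.
- by move=> _ [[] []] [[] []].
- by move=> _ U V; exact: unitmx_mul.
- exists 1%N; do 2!eexists; split; first exact: (pbs_eq2 0%R).
  by move/rel_eq2/(_ (false, true)); rewrite /= unitmx0.
Qed.

(** Negation preserves equality of the two bits, but the beam splitter sends 00,11 to 10,01. *)
Lemma eq3_independent : (0 < q)%N -> pbs_independent 3.
Proof.
move=> q_gt0.
apply: (@test_independent 3 (mem unitmx) (fun a => a.1 == a.2)) => //.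
- by exists (false, false).
- by move=> _; exact: unitmx1.
- by move=> _ U V; exact: unitmx_mul.
- exists 2%N; do 2!eexists; split; first exact: (pbs_eq3 0%R).
  by move/rel_eq3/(_ (false, false) (true, true)); rewrite /= unitmx0.
Qed.

End Independence.

Theorem theorem24 (R : realType) (q : nat) (hq : (1 <= q)%N)
    (i : nat) (hi : (1 <= i <= 10)%N) :
  ~ (forall (n : nat) (D D' : term R q),
       pbs_equation i n D D' -> pbs_without i n D D').
Proof.
change (pbs_independent R q i).
case: i hi => [|[|[|[|[|[|[|[|[|[|[|i]]]]]]]]]]] // _.
- exact: eq1_independent.
- exact: eq2_independent.
- exact: eq3_independent.
- exact: eq4_independent.
- exact: eq5_independent.
- exact: eq6_independent.
- exact: eq7_independent.
- exact: eq8_independent.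
- exact: eq9_independent.
- exact: eq10_independent.
Qed.
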